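(* The amalgamation bases for $\mathrm{Emb}(T_{\mathrm{E\text{-}field}})$ are precisely the EA-fields. Furthermore, every EA-field is a disjoint amalgamation base for $\mathrm{Emb}(T_{\mathrm{E\text{-}field}})$.
   Context: $T_{\mathrm{E\text{-}field}}$ is the theory of exponential fields: fields of characteristic $0$ with a homomorphism $E:(F,+)\to(F^\times,\cdot)$, in the language $\{+,-,\cdot,0,1,E\}$. $\mathrm{Emb}(T_{\mathrm{E\text{-}field}})$ is the category of exponential fields with embeddings. An EA-field is an exponential field whose underlying field is algebraically closed. $A$ is an amalgamation base if for any embeddings $f_i:A\to B_i$ ($i=1,2$) into exponential fields there are an exponential field $C$ and embeddings $g_i:B_i\to C$ with $g_1f_1=g_2f_2$; it is a disjoint amalgamation base if moreover the $g_i$ can be chosen with $g_1(B_1)\cap g_2(B_2)=g_1f_1(A)$. *)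

(* Defs.v *)
From HB Require Import structures.
From mathcomp Require Import all_boot all_order all_algebra.
From mathcomp Require Import classical_sets.

Set Implicit Arguments.
Unset Strict Implicit.
Unset Printing Implicit Defensive.

Import GRing.Theory.
Local Open Scope classical_set_scope.
Local Open Scope ring_scope.

(* [expE_neq0] and [expED] together say that [expE] is a group homomorphism
   from (F, +) to the multiplicative group of nonzero elements of F. *)
Record expField := ExpField {
  expField_fieldType :> fieldType;
  expField_pchar0 : [pchar expField_fieldType] =i pred0;
  expE : expField_fieldType -> expField_fieldType;
  expE_neq0 : forall x, expE x != 0;
  expED : {morph expE : x y / x + y >-> x * y}
}.

Record embedding (A B : expField) := Embedding {
  embedding_rmorphism :> {rmorphism A -> B};
  embedding_inj : injective embedding_rmorphism;
  embeddingE : {morph embedding_rmorphism : x / expE x >-> expE x}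
}.

Definition EA_field (A : expField) : Prop := GRing.closed_field_axiom A.

Definition amalgamation_base (A : expField) : Prop :=
  forall (B1 B2 : expField) (f1 : embedding A B1) (f2 : embedding A B2),
  exists (C : expField) (g1 : embedding B1 C) (g2 : embedding B2 C),
    g1 \o f1 =1 g2 \o f2.

Definition disjoint_amalgamation_base (A : expField) : Prop :=
  forall (B1 B2 : expField) (f1 : embedding A B1) (f2 : embedding A B2),
  exists (C : expField) (g1 : embedding B1 C) (g2 : embedding B2 C),
    g1 \o f1 =1 g2 \o f2 /\
    range g1 `&` range g2 = range (g1 \o f1).

(* Main.v *)
(** A homomorphism into the multiplicative group of [F], defined on a divisible
subgroup of the additive group of [F], extends to all of [F]: precompose it
with a retraction onto the subgroup. So exponentials extend freely, and only
fields need to be built.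

Let [A] be algebraically closed. By the Nullstellensatz every finitely
generated [A]-subalgebra of [B1] has an [A]-point, so [B1] embeds over [A] in an
ultrapower of [A]. Inside the corresponding ultrapower of [B2], the ultrapower
of [A] meets the diagonal copy of [B2] exactly in [A]; hence [B1] and [B2] are
amalgamated disjointly as fields. The two exponentials agree on the
intersection, so they define one on [B1 + B2], which extends.

Conversely let [p] have no root in [A], let [L] be a splitting field of [p] and
[b] a root in [L]. In an ultrapower [F] of [L(X)] the class of the sequence
[X ^ n!] has roots of all orders, so [F] carries an exponential extending that of [A] which sends
[b] outside [L], and another one with values in [A]. These two exponential
fields have no amalgam over [A], because the roots of [p] in an amalgam would be
the same set for both. *)

Require Import Defs.
From HB Require Import structures.
From mathcomp Require Import all_boot all_order all_algebra all_field.
From mathcomp Require Import boolp classical_sets functions filter.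
From mathcomp Require Import ring.

Set Implicit Arguments.
Unset Strict Implicit.
Unset Printing Implicit Defensive.

Import GRing.Theory.
Local Open Scope classical_set_scope.
Local Open Scope ring_scope.

(** * Divisible groups and the extension of exponentials *)

Lemma pchar0_natf_neq0 (F : fieldType) (n : nat) :
  [pchar F] =i pred0 -> n.+1%:R != 0 :> F.
Proof. by move=> F0; rewrite (pcharf0P F).1. Qed.

Lemma pchar0_mulrn_eq0 (F : fieldType) (n : nat) (x : F) :
  [pchar F] =i pred0 -> x *+ n.+1 = 0 -> x = 0.
Proof.
move=> F0 /eqP; rewrite -[X in X == 0]mulr_natr mulf_eq0 (negPf (pchar0_natf_neq0 n F0)).
by rewrite orbF => /eqP.
Qed.

Definition divisible (G : zmodType) :=
  forall (n : nat) (x : G), exists y, y *+ n.+1 = x.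

Lemma pchar0_divisible (F : fieldType) : [pchar F] =i pred0 -> divisible F.
Proof.
move=> F0 n x; exists (x / n.+1%:R).
by rewrite -[LHS]mulr_natr divfK ?pchar0_natf_neq0.
Qed.

Lemma divisible_prod (G H : zmodType) :
  divisible G -> divisible H -> divisible (G * H)%type.
Proof.
move=> dG dH n [x y]; have [x' <-] := dG n x; have [y' <-] := dH n y.
exists (x', y'); elim: n => [|n IHn]; first by rewrite !mulr1n.
by rewrite mulrS IHn !(mulrS _ n.+1).
Qed.

Section PureComplement.

Variables (G F : zmodType) (u : {additive G -> F}).
Hypotheses (divG : divisible G).
Hypothesis torsionfreeF : forall (n : nat) (x : F), x *+ n.+1 = 0 -> x = 0.

Let pure_indep (W : set F) :=
  [/\ forall x y, W x -> W y -> W (x - y),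
      forall n x, W (x *+ n.+1) -> W x
    & forall g, W (u g) -> u g = 0].

(** Zorn's lemma for pure subgroups meeting the image of [u] trivially. If [x] lay outside [W + u G]
    for a maximal [W], divisibility of [G] and purity of [W] would keep all its nonzero multiples
    outside too, and [x] could be adjoined. *)
Lemma divisible_image_complement :
  exists W : set F, [/\ forall x y, W x -> W y -> W (x - y),
    forall g, W (u g) -> u g = 0 & forall x, exists g, W (x - u g)].
Proof.
have [|W [[Wsub Wpure Wu] Wmax]] := @Zorn_bigcup F pure_indep.
  move=> C CP Ctot; split.
  - move=> x y [X CX Xx] [Y CY Yy].
    have [XY|YX] := Ctot _ _ CX CY.
      by exists Y => //; have [sub _ _] := CP _ CY; apply: sub => //; apply: XY.
    by exists X => //; have [sub _ _] := CP _ CX; apply: sub => //; apply: YX.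
  - by move=> n x [X CX Xx]; exists X => //; have [_ /(_ n x) + _] := CP _ CX; exact.
  - by move=> g [X CX Xg]; have [_ _] := CP _ CX; exact.
(* The empty set satisfies [pure_indep], so [0] enters [W] only by maximality, tested against
   [[set 0]]. *)
have W0 : W 0.
  apply: contrapT => W0; apply: (Wmax [set 0]).
    split; last by move=> /(_ 0 erefl).
    by move=> x Wx; case: W0; rewrite -(subrr x); apply: Wsub.
  split=> [x y -> ->|n x /torsionfreeF -> //|g //].
  by rewrite subr0.
have WN x : W x -> W (- x) by move=> Wx; rewrite -sub0r; apply: Wsub.
have WD x y : W x -> W y -> W (x + y).
  by move=> Wx Wy; rewrite -(opprK y); apply: Wsub => //; apply: WN.
have WMn n x : W x -> W (x *+ n).
  by move=> Wx; elim: n => [|n IHn]; rewrite ?mulr0n // mulrS; apply: WD.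
have WMz (k : int) x : W x -> W (x *~ k).
  by move=> Wx; case: k => k; rewrite ?NegzE ?mulrNz -pmulrn; [|apply: WN]; apply: WMn.
exists W; split=> // x; apply: contrapT => nx.
(* The pure closure of the subgroup generated by [W] and [x]. *)
pose W' := [set y | exists n w k, W w /\ y *+ n.+1 = w + x *~ k].
have notkx (k : int) (g : G) : k != 0 -> ~ W (x *~ k - u g).
  move=> k0 Wkx; apply: nx.
  wlog [n kE] : k g k0 Wkx / exists n, k = n.+1%:Z.
    case: k k0 Wkx => [[|n]|n] // k0 Wkx; first by move/(_ _ _ k0 Wkx); apply; exists n.
    move/(_ n.+1%:Z (- g) isT); apply; last by exists n.
    have := WN _ Wkx; rewrite opprD NegzE mulrNz !opprK raddfN opprK.
    by [].
  have [h hg] := divG n g; exists h; apply: (Wpure n).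
  by rewrite mulrnBl -raddfMn hg; move: Wkx; rewrite kE.
apply: (Wmax W').
  split; first by move=> y Wy; exists 0%N, y, 0; rewrite mulr0z addr0.
  move=> W'W; apply: nx; exists 0; rewrite raddf0 subr0; apply: W'W.
  by exists 0%N, 0, 1; rewrite add0r.
split.
- move=> y z [n [w [k [Ww yE]]]] [n' [w' [k' [Ww' zE]]]].
  exists (n.+1 * n'.+1).-1, (w *+ n'.+1 - w' *+ n.+1), (k * n'.+1 - k' * n.+1).
  split; first by apply: Wsub; apply: WMn.
  rewrite prednK ?muln_gt0 // mulrnBl mulrnA yE mulnC mulrnA zE !mulrnDl.
  by rewrite mulrzBr !mulrzA -!pmulrn opprD addrACA.
- move=> n y [m [w [k [Ww]]]]; rewrite -mulrnA => yE.
  by exists (n.+1 * m.+1).-1, w, k; rewrite prednK ?muln_gt0.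
- move=> g [n [w [k [Ww ugE]]]].
  have [k0|k0] := eqVneq k 0.
    move: ugE; rewrite k0 mulr0z addr0 => ugE.
    by apply: (@torsionfreeF n); rewrite -raddfMn Wu // raddfMn ugE.
  have := @notkx k (g *+ n.+1) k0; rewrite raddfMn ugE opprD addrCA subrr addr0.
  by case; apply: WN.
Qed.

End PureComplement.

(** With [W] a complement of the image, [E x] is [e g] for any [g] with [x - u g] in [W]. The kernel
    condition makes this independent of [g], so the choice [p] need not be additive. The last clause
    serves the converse, where one exponential must take its values in [A]. *)
Lemma exp_extension (G : zmodType) (F : fieldType) (u : {additive G -> F})
    (e : G -> F) :
  [pchar F] =i pred0 -> divisible G ->
  (forall g, e g != 0) -> {morph e : g h / g + h >-> g * h} ->
  (forall g, u g = 0 -> e g = 1) ->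
  exists E : F -> F, [/\ forall x, E x != 0, {morph E : x y / x + y >-> x * y},
    forall g, E (u g) = e g & forall x, exists g, E x = e g].
Proof.
move=> F0 divG e0 eD eker.
have [|W [WB Wu Wcompl]] := @divisible_image_complement G F u divG.
  by move=> n x; apply: pchar0_mulrn_eq0.
have [p pW] := choice Wcompl.
have eqe g h : W (u g - u h) -> e g = e h.
  rewrite -raddfB => /Wu /eker; rewrite -{2}(subrK h g) eD => ->.
  by rewrite mul1r.
have W0 : W 0 by rewrite -(subrr (0 - u (p 0))); apply: WB.
exists (e \o p); split=> [x|x y|g|x] /=; last by exists (p x).
- exact: e0.
- rewrite -eD; apply: eqe; rewrite raddfD.
  have -> : u (p (x + y)) - (u (p x) + u (p y)) =
      x - u (p x) - (0 - (y - u (p y))) - (x + y - u (p (x + y))).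
    by ring.
  by apply: (WB _ _ (WB _ _ _ (WB _ _ _ _))).
- by apply: eqe; rewrite -opprB -sub0r; apply: WB.
Qed.

(** * Ultrapowers of fields *)

Section Ultrapower.

Variables (I : pointedType) (K : fieldType) (U : set_system I).
Hypothesis ultraU : UltraFilter U.

(** The ultrafilter proof is an argument so that the ideal structure, which depends on it, can be
    inferred from the term. *)
Definition ae_zero & UltraFilter U : pred (I -> K) :=
  fun f => `[< U [set i | f i = 0] >].

Lemma ae_zero_idealr : idealr_closed (ae_zero ultraU).
Proof.
split=> [||a f g].
- by apply/asboolP; apply: filterS filterT.
- apply/asboolP => U0; have [i /eqP] := filter_ex U0.
  by rewrite /GRing.one /= oner_eq0.
- move=> /asboolP Uf /asboolP Ug; apply/asboolP.
  apply: filterS (filterI Uf Ug) => i /= [fi gi].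
  by rewrite /GRing.add /= /GRing.mul /= fi gi mulr0 addr0.
Qed.

HB.instance Definition _ :=
  isIdealr.Build (I -> K) (ae_zero ultraU) ae_zero_idealr.

Definition ultrapower : Type :=
  {ideal_quot (ae_zero ultraU : idealr (I -> K))}.
HB.instance Definition _ := GRing.ComNzRing.on ultrapower.

Definition ultraclass (f : I -> K) : ultrapower :=
  (\pi_({ideal_quot (ae_zero ultraU : idealr (I -> K))}) f)%qT.

Lemma ultraclass_zmod_morphism : zmod_morphism ultraclass.
Proof. exact: (rmorphB (\pi_({ideal_quot (ae_zero ultraU : idealr (I -> K))}))%qT). Qed.

Lemma ultraclass_monoid_morphism : monoid_morphism ultraclass.
Proof.
split; first exact: (rmorph1 (\pi_({ideal_quot (ae_zero ultraU : idealr (I -> K))}))%qT).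
exact: (rmorphM (\pi_({ideal_quot (ae_zero ultraU : idealr (I -> K))}))%qT).
Qed.

HB.instance Definition _ := GRing.isZmodMorphism.Build (I -> K) ultrapower
  ultraclass ultraclass_zmod_morphism.
HB.instance Definition _ := GRing.isMonoidMorphism.Build (I -> K) ultrapower
  ultraclass ultraclass_monoid_morphism.

Lemma ultraclassP (f g : I -> K) :
  ultraclass f = ultraclass g <-> U [set i | f i = g i].
Proof.
rewrite (_ : [set i | f i = g i] = [set i | (f - g) i = 0]); last first.
  by apply/seteqP; split=> i; rewrite /= -[(f - g) i]/(f i - g i);
    [move=> ->; rewrite subrr|move=> /subr0_eq].
split=> [/eqP|Ufg]; first by rewrite -Quotient.idealrBE => /asboolP.
by apply/eqP; rewrite -Quotient.idealrBE; apply/asboolP.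
Qed.

Definition ultrainv (x : ultrapower) := ultraclass (fun i => (repr x i)^-1).

Lemma ultrapower_mulVf (x : ultrapower) : x != 0 -> ultrainv x * x = 1.
Proof.
rewrite /ultrainv -{1 3}[x]reprK -[\pi%qT _]/(ultraclass _); move: (repr x) => f.
rewrite -(rmorph0 ultraclass) -(rmorph1 ultraclass) -rmorphM => /eqP f0.
apply/ultraclassP.
have [Uf|Uf] := in_ultra_setVsetC [set i | f i = 0] ultraU.
  by case: f0; apply/ultraclassP.
apply: filterS Uf => i /= /eqP fi.
by rewrite /GRing.mul /= mulVf.
Qed.

Lemma ultrapower_inv0 : ultrainv 0 = 0.
Proof.
rewrite /ultrainv -[RHS](rmorph0 ultraclass); apply/ultraclassP.
have /ultraclassP : ultraclass (repr (0 : ultrapower)) = ultraclass 0.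
  by rewrite rmorph0 /ultraclass reprK.
by apply: filterS => i /= ->; rewrite /GRing.zero /= invr0.
Qed.

HB.instance Definition _ :=
  GRing.ComNzRing_isField.Build ultrapower ultrapower_mulVf ultrapower_inv0.

Lemma ultrapower_exists_pointed :
  exists (F : fieldType) (c : {rmorphism (I -> K) -> F}),
    forall f g, c f = c g <-> U [set i | f i = g i].
Proof. by exists ultrapower, ultraclass; exact: ultraclassP. Qed.

End Ultrapower.

Lemma ultrapower_exists (I : choiceType) (K : fieldType) (U : set_system I) :
    UltraFilter U ->
  exists (F : fieldType) (c : {rmorphism (I -> K) -> F}),
    forall f g, c f = c g <-> U [set i | f i = g i].
Proof.
move=> ultraU; have [i0 _] := filter_ex (filterT : U setT).
pose I' : pointedType := HB.pack I (isPointed.Build I i0).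
exact: (@ultrapower_exists_pointed I' K U ultraU).
Qed.

(** The sets [B i] form a base of a proper filter. They will be the lists containing a given list,
    and the tails of [nat]. *)
Lemma cofinal_ultrafilter (I : Type) (B : I -> set I) :
  inhabited I -> (forall i, B i i) ->
  (forall i j, exists k, B k `<=` B i `&` B j) ->
  exists U : set_system I, UltraFilter U /\ forall i, U (B i).
Proof.
move=> [i0] Brefl Bdir.
have FP : ProperFilter (filter_from setT B).
  apply: filter_from_proper; last by move=> i _; exists i.
  apply: filter_from_filter; first by exists i0.
  by move=> i j _ _; have [k kij] := Bdir i j; exists k.
have [U [UU FU]] := ultraFilterLemma FP.
by exists U; split=> // i; apply: FU; exists i.
Qed.

(** * The Nullstellensatz by specialization *)

Lemma closed_field_root (A : fieldType) (p : {poly A}) :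
  GRing.closed_field_axiom A -> (1 < size p)%N -> exists x, root p x.
Proof.
move=> clA p1; have p0 : p != 0 by rewrite -size_poly_gt0 ltnW.
(* [closed_field_axiom] solves monic equations, hence the division by [lead_coef p]. *)
have [|x xE] := clA (size p).-1 (fun i => - p`_i / lead_coef p).
  by rewrite -ltnS prednK // ltnW.
exists x; apply/eqP; rewrite horner_coef.
case szp: (size p) p1 xE => [|n] // _ xE.
rewrite big_ord_recr /= xE mulr_sumr -big_split big1 // => i _ /=.
rewrite mulrA [p`_n * _]mulrC.
have -> : p`_n = lead_coef p by rewrite lead_coefE szp.
by rewrite divfK ?lead_coef_eq0 // mulNr subrr.
Qed.

Lemma closed_field_nonroot (A : fieldType) (p : {poly A}) :
  GRing.closed_field_axiom A -> p != 0 -> exists x, ~~ root p x.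
Proof.
move=> clA p0; have [p1|p1] := leqP (size p) 1.
  exists 0; move: p0; rewrite (size1_polyC p1) rootC.
  by rewrite polyC_eq0.
have [|x] := @closed_field_root A (p - 1) clA.
  by rewrite size_polyDl // size_polyN size_poly1.
by rewrite rootE !hornerE subr_eq0 => /eqP px; exists x; rewrite rootE px oner_eq0.
Qed.

Lemma min_size_poly (R : nzRingType) (Q : {poly R} -> Prop) :
  (exists q, Q q) -> exists2 q, Q q & forall q', Q q' -> (size q <= size q')%N.
Proof.
move=> [q Qq]; pose S n := `[< exists2 q', Q q' & size q' = n >].
have exS : exists n, S n by exists (size q); apply/asboolP; exists q.
case: (ex_minnP exS) => n /asboolP[q' Qq' szq'] minn; exists q' => // q'' Qq''.
by rewrite szq'; apply: minn; apply/asboolP; exists q''.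
Qed.

(** Ensures that a nonzero polynomial of least size, for a property depending only on its image, has
    leading coefficient outside the kernel of [f]. *)
Lemma map_poly_drop_lead (R S : nzRingType) (f : {rmorphism R -> S})
    (q : {poly R}) : q != 0 -> f (lead_coef q) = 0 ->
  exists2 q' : {poly R}, (size q' < size q)%N & map_poly f q' = map_poly f q.
Proof.
rewrite -size_poly_gt0 => q0 fq0; exists (take_poly (size q).-1 q).
  by rewrite -[ltnRHS]prednK // ltnS size_take_poly.
apply/polyP => i; rewrite !coef_map coef_take_poly; case: ltnP => // iq.
rewrite raddf0; have [->|ni] := eqVneq i (size q).-1; first by rewrite -lead_coefE.
by rewrite nth_default ?raddf0 // -(prednK q0) ltn_neqAle eq_sym ni.
Qed.

Section Specialization.

Variables (A B : fieldType).
Hypothesis clA : GRing.closed_field_axiom A.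

(* [P] presents the subring [i P] of [B]: the last clause makes [phi] factor
   through it, so that no subring of [B] has to be formed. *)
Definition specializable (P : idomainType) (k : {rmorphism A -> P})
    (i : {rmorphism P -> B}) :=
  forall h, i h != 0 -> exists phi : {rmorphism P -> A},
    [/\ forall a, phi (k a) = a, phi h != 0 & forall p, i p = 0 -> phi p = 0].

Section Step.

Variables (P : idomainType) (k : {rmorphism A -> P}) (i : {rmorphism P -> B}).
Variable b : B.

Let commib : commr_rmorph i b. Proof. by move=> x; apply: mulrC. Qed.
(** Presents the subring of [B] generated by [i P] and [b]. *)
Definition eval_at : {rmorphism {poly P} -> B} := horner_morph commib.

Lemma eval_atE q : eval_at q = (map_poly i q).[b]. Proof. by []. Qed.

Lemma eval_atC c : eval_at c%:P = i c.
Proof. by rewrite eval_atE map_polyC hornerC. Qed.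

Lemma eval_atX : eval_at 'X = b.
Proof. by rewrite eval_atE map_polyX hornerX. Qed.

Lemma eval_atD p q : eval_at (p + q) = eval_at p + eval_at q.
Proof. exact: rmorphD. Qed.

Lemma eval_atM p q : eval_at (p * q) = eval_at p * eval_at q.
Proof. exact: rmorphM. Qed.

Lemma eval_atZ c q : eval_at (c *: q) = i c * eval_at q.
Proof. by rewrite -mul_polyC eval_atM eval_atC. Qed.

Lemma eval_at_map_eq p q :
  map_poly i p = map_poly i q -> eval_at p = eval_at q.
Proof. by rewrite !eval_atE => ->. Qed.

Section Algebraic.

Variable m : {poly P}.
Hypotheses (m0 : map_poly i m != 0) (mb : eval_at m = 0).
Hypothesis minm :
  forall q, map_poly i q != 0 -> eval_at q = 0 -> (size m <= size q)%N.

Let small (q : {poly P}) :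
  (size q < size m)%N -> eval_at q = 0 -> map_poly i q = 0.
Proof.
move=> qm qb; apply/eqP; apply: contraLR qm => q0.
by rewrite -leqNgt minm.
Qed.

Lemma minimal_neq0 : m != 0.
Proof. by apply: contraNneq m0 => ->; rewrite rmorph0. Qed.

Lemma minimal_lead_neq0 : i (lead_coef m) != 0.
Proof.
apply/eqP => /(map_poly_drop_lead minimal_neq0)[q qm mq].
by have /negP[] := m0; rewrite -mq small // (eval_at_map_eq mq).
Qed.

Lemma minimal_size_gt1 : (1 < size m)%N.
Proof.
rewrite ltnNge; apply/negP => m1; have := mb.
rewrite (size1_polyC m1) eval_atC => c0.
by have /negP[] := m0; rewrite (size1_polyC m1) map_polyC /= c0.
Qed.

(** Replaces inverting [h] at [b], by Euclid's algorithm against [m], which plays the minimal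
    polynomial of [b]. Among polynomials whose value at [b] is nonzero and is that of a multiple of
    [h], one of least size is constant. *)
Lemma eval_at_norm h : eval_at h != 0 ->
  exists g d, eval_at (g * h) = i d /\ i d != 0.
Proof.
move=> hb.
have [|r [rb [g rE]] minr] := @min_size_poly P
    (fun r => eval_at r != 0 /\ exists g, eval_at r = eval_at (g * h)).
  by exists h; split=> //; exists 1; rewrite mul1r.
have r0 : r != 0 by apply: contraNneq rb => ->; rewrite rmorph0.
have lr : i (lead_coef r) != 0.
  apply/eqP => /(map_poly_drop_lead r0)[r' r'r /eval_at_map_eq r'E].
  by move: r'r; rewrite ltnNge minr // r'E; split=> //; exists g.
have [r1|r1] := leqP (size r) 1.
  by exists g, r`_0; rewrite -rE -(eval_atC r`_0) -size1_polyC.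
have lekM c n : i c != 0 -> i (c ^+ n) != 0 by move=> c0; rewrite rmorphXn expf_neq0.
(* Otherwise the pseudo-remainder of [r] by [m] is a shorter candidate. *)
have rm : (size r < size m)%N.
  rewrite ltnNge; apply/negP => mr.
  have := ltn_modp r m; rewrite minimal_neq0 => szr.
  have := leq_trans szr mr; rewrite ltnNge minr //.
  have : eval_at (r %% m) = i (lead_coef m ^+ scalp r m) * eval_at r.
    by rewrite -eval_atZ Pdiv.Idomain.divp_eq eval_atD eval_atM mb mulr0 add0r.
  move=> ->; split; first by rewrite mulf_neq0 // lekM // minimal_lead_neq0.
  by exists (lead_coef m ^+ scalp r m *: g); rewrite -scalerAl eval_atZ rE.
(* At [b] the remainder of [m] by [r] is a multiple of [r], so a shorter candidate unless it
   vanishes. If it does, quotient and remainder both vanish at [b] and are shorter than [m], so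
   their images are zero, and so is that of a power of [lead_coef r] times [m]. *)
have := congr1 eval_at (Pdiv.Idomain.divp_eq m r).
rewrite eval_atZ mb mulr0 eval_atD eval_atM => /esym/eqP.
rewrite addrC addr_eq0 => /eqP sE.
have := ltn_modp m r; rewrite r0 => szs.
have [s0|s0] := eqVneq (eval_at (m %% r)) 0; last first.
  have := szs; rewrite ltnNge minr //; split=> //.
  exists (- (m %/ r) * g).
  by rewrite sE -mulrA mulNr -scaleN1r eval_atZ rmorphN1 mulN1r eval_atM rE.
have u0 : eval_at (m %/ r) = 0.
  apply/eqP; move: sE; rewrite s0 => /esym/eqP; rewrite oppr_eq0 mulf_eq0.
  by rewrite (negPf rb) orbF.
have mapu0 : map_poly i (m %/ r) = 0.
  apply: small => //; rewrite Pdiv.Idomain.size_divp //.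
  by rewrite ltn_subrL -ltnS prednK ?(ltnW r1) // r1 (ltnW minimal_size_gt1).
have := congr1 (map_poly i) (Pdiv.Idomain.divp_eq m r).
rewrite rmorphD rmorphM /= mapu0 mul0r (@small (m %% r)) ?(ltn_trans szs) // addr0.
move=> /eqP; rewrite map_polyZ scaler_eq0 (negPf m0) orbF => /eqP lr0.
by have := lekM _ (scalp m r) lr; rewrite lr0 eqxx.
Qed.

End Algebraic.

Lemma specializable_poly :
  specializable k i -> specializable (polyC \o k) eval_at.
Proof.
move=> spec h hb.
have commA (phi : {rmorphism P -> A}) a : commr_rmorph phi a.
  by move=> x; apply: mulrC.
have [trans|alg] := pselect (forall q, eval_at q = 0 -> map_poly i q = 0).
  (* Transcendental [b]: it goes to any nonroot of [map_poly phi h], which is nonzero once [phi]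
     keeps the leading coefficient of the image of [h] alive. *)
  have : map_poly i h != 0.
    by apply: contraNneq hb => h0; rewrite eval_atE h0 horner0.
  rewrite -lead_coef_eq0 lead_coefE coef_map => /spec[phi [phik phih phiker]].
  have hphi : map_poly phi h != 0.
    apply: contraNneq phih => /(congr1 (fun p : {poly A} => p`_(size (map_poly i h)).-1)).
    by rewrite coef_map coef0 /= => ->.
  have [a ha] := closed_field_nonroot clA hphi.
  exists (horner_morph (commA phi a)); split=> [c||q /trans q0] /=.
  - by rewrite /horner_morph map_polyC hornerC; exact: phik.
  - by [].
  - rewrite /horner_morph (_ : map_poly phi q = 0) ?horner0 //.
    apply/polyP => n; rewrite coef_map coef0; apply: phiker.
    by rewrite -coef_map q0 coef0.
have [|m [mb m0] minm] :=
    @min_size_poly P (fun q => eval_at q = 0 /\ map_poly i q != 0).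
  apply: contrapT => nq; apply: alg => q qb; apply/eqP; apply: contrapT => q0.
  by apply: nq; exists q; split=> //; apply/negP.
have {}minm q : map_poly i q != 0 -> eval_at q = 0 -> (size m <= size q)%N.
  by move=> q0 qb; apply: minm.
have [g [d [gh d0]]] := eval_at_norm m0 mb minm hb.
(* Algebraic [b]: it goes to a root [a] of [map_poly phi m]. Keeping [lead_coef m] alive preserves
   the size of [m] and permits pseudo-division; keeping [d] alive makes [h] nonzero at [a], since
   [g * h] takes the value [phi d] there. *)
have := mulf_neq0 (minimal_lead_neq0 m0 mb minm) d0.
rewrite -rmorphM => /spec[phi [phik]]; rewrite rmorphM mulf_eq0 negb_or.
move=> /andP[phim phid] phiker.
have phimap q : map_poly i q = 0 -> map_poly phi q = 0.
  move=> q0; apply/polyP => n; rewrite coef_map coef0; apply: phiker.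
  by rewrite -coef_map q0 coef0.
have [|a am] := @closed_field_root A (map_poly phi m) clA.
  by rewrite size_map_poly_id0 // (minimal_size_gt1 m0 mb).
have phi'ker q : eval_at q = 0 -> (map_poly phi q).[a] = 0.
  move=> qb; have := congr1 (map_poly phi) (Pdiv.Idomain.divp_eq q m).
  rewrite map_polyZ rmorphD rmorphM /= (phimap (q %% m)) ?addr0; last first.
    apply/eqP; apply: contraT => r0.
    have := ltn_modp q m; rewrite (minimal_neq0 m0) ltnNge minm //.
    have := congr1 eval_at (Pdiv.Idomain.divp_eq q m).
    by rewrite eval_atZ eval_atD eval_atM mb qb !mulr0 add0r.
  move/(congr1 (horner^~ a)); rewrite hornerZ hornerM (eqP am) mulr0 => /eqP.
  by rewrite mulf_eq0 rmorphXn expf_eq0 (negPf phim) andbF => /eqP.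
exists (horner_morph (commA phi a)); split=> [c||q qb] /=.
- by rewrite /horner_morph map_polyC hornerC; exact: phik.
- apply: contraNneq phid; rewrite /horner_morph => ha.
  have /phi'ker : eval_at (g * h - d%:P) = 0 by rewrite rmorphB /= gh eval_atC subrr.
  rewrite rmorphB rmorphM /= map_polyC !hornerE ha mulr0 sub0r => /eqP.
  by rewrite oppr_eq0.
- exact: phi'ker.
Qed.

End Step.

Variable f : {rmorphism A -> B}.

Lemma specializable_cover (s : seq B) :
  exists (P : idomainType) (k : {rmorphism A -> P}) (i : {rmorphism P -> B}),
    [/\ specializable k i, i \o k =1 f & forall x, x \in s -> exists p, i p = x].
Proof.
elim: s => [|b s [P [k [i [spec ik cov]]]]].
  exists A, idfun, f; split=> // h h0; exists idfun; split=> //=.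
    by apply: contraNneq h0 => ->; rewrite rmorph0.
  by move=> p /eqP; rewrite fmorph_eq0 => /eqP.
exists {poly P}, (polyC \o k), (eval_at i b); split=> [|a|x].
- exact: specializable_poly.
- by rewrite /= eval_atC -ik.
- rewrite inE => /predU1P[->|/cov[p <-]]; first by exists 'X; rewrite eval_atX.
  by exists p%:P; rewrite eval_atC.
Qed.

(** An [A]-point of the algebra generated by [s], made a total function so that an ultrafilter on
    the lists [s] can assemble these points. *)
Lemma finite_specialization (s : seq B) :
  exists psi : B -> A, (forall a, psi (f a) = a) /\
    {in s &, forall x y,
      psi (x + y) = psi x + psi y /\ psi (x * y) = psi x * psi y}.
Proof.
have [P [k [i [spec ik cov]]]] := specializable_cover s.
have [|phi [phik _ phiker]] := spec 1; first by rewrite rmorph1 oner_neq0.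
have phieq p q : i p = i q -> phi p = phi q.
  by move=> /eqP; rewrite -subr_eq0 -rmorphB => /eqP/phiker; rewrite rmorphB => /subr0_eq.
have [psi psiE] : exists psi : B -> A, forall p, psi (i p) = phi p.
  suff /choice[psi psiE] : forall x, exists a, forall p, i p = x -> phi p = a.
    by exists psi => p; rewrite -(psiE (i p) p).
  move=> x; have [[p px]|nx] := pselect (exists p, i p = x).
    by exists (phi p) => q qx; apply: phieq; rewrite px.
  by exists 0 => p px; case: nx; exists p.
exists psi; split=> [a|x y /cov[p <-] /cov[q <-]].
  by rewrite -ik psiE.
by rewrite -rmorphD -rmorphM !psiE rmorphD rmorphM.
Qed.

End Specialization.

(** * Disjoint amalgamation over an EA-field *)

Lemma additive_of_morph (G H : zmodType) (g : G -> H) :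
  {morph g : x y / x + y} -> exists h : {additive G -> H}, h =1 g.
Proof.
move=> gD.
have g0 : g 0 = 0 by apply: (addIr (g 0)); rewrite -gD !add0r.
have gB : zmod_morphism g.
  by move=> x y; apply: (addIr (g y)); rewrite -gD !subrK.
pose gadd := GRing.isZmodMorphism.Build G H g gB.
by pose h : {additive G -> H} := HB.pack g gadd; exists h.
Qed.

Lemma rmorphism_of_morph (R S : nzRingType) (g : R -> S) :
    {morph g : x y / x + y} -> {morph g : x y / x * y} -> g 1 = 1 ->
  exists h : {rmorphism R -> S}, h =1 g.
Proof.
move=> gD gM g1; have [h hg] := additive_of_morph gD.
have gB : zmod_morphism g by move=> x y; rewrite -!hg raddfB.
pose gadd := GRing.isZmodMorphism.Build R S g gB.
pose gmul := GRing.isMonoidMorphism.Build R S g (g1, gM).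
by pose h' : {rmorphism R -> S} := HB.pack g gadd gmul; exists h'.
Qed.

Lemma constant_class_rmorphism (I : Type) (K F : fieldType)
    (c : {rmorphism (I -> K) -> F}) :
  exists j : {rmorphism K -> F}, forall x, j x = c (fun=> x).
Proof.
apply: rmorphism_of_morph => [x y|x y|]; rewrite -?rmorphD -?rmorphM //.
by rewrite -(rmorph1 c).
Qed.

(* The field [B1] maps over [A] into an ultrapower of [A], which meets the
   diagonal copy of [B2] inside the ultrapower of [B2] exactly in [A]. *)
Lemma field_disjoint_amalgam (A B1 B2 : fieldType)
    (f1 : {rmorphism A -> B1}) (f2 : {rmorphism A -> B2}) :
    GRing.closed_field_axiom A ->
  exists (F : fieldType) (j1 : {rmorphism B1 -> F}) (j2 : {rmorphism B2 -> F}),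
    (forall a, j1 (f1 a) = j2 (f2 a)) /\
    forall x y, j1 x = j2 y -> exists a, x = f1 a /\ y = f2 a.
Proof.
move=> clA.
have [psi psiP] := choice (finite_specialization clA f1).
have [|||U [ultraU UB]] :=
    @cofinal_ultrafilter (seq B1) (fun s => [set t : seq B1 | {subset s <= t}]).
- by split; exact: [::].
- by move=> s x.
- move=> s t; exists (s ++ t) => r str.
  by split=> x xs; apply: str; rewrite mem_cat xs ?orbT.
have [F [c cP]] := @ultrapower_exists (seq B1) B2 U ultraU.
have [j2 j2E] := constant_class_rmorphism c.
(* The morphism laws at [x] and [y] hold at every index containing both. *)
have [|||j1 j1E] := @rmorphism_of_morph B1 F (fun x => c (fun s => f2 (psi s x))).
- move=> x y; rewrite -rmorphD; apply/cP.
  apply: filterS (UB [:: x; y]) => s xys /=; rewrite -[RHS]rmorphD.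
  have [xs ys] : x \in s /\ y \in s by split; apply: xys; rewrite !inE eqxx ?orbT.
  by rewrite ((psiP s).2 x y xs ys).1.
- move=> x y; rewrite -rmorphM; apply/cP.
  apply: filterS (UB [:: x; y]) => s xys /=; rewrite -[RHS]rmorphM.
  have [xs ys] : x \in s /\ y \in s by split; apply: xys; rewrite !inE eqxx ?orbT.
  by rewrite ((psiP s).2 x y xs ys).2.
- rewrite -(rmorph1 c); apply/cP; apply: filterS filterT => s _ /=.
  by rewrite -(rmorph1 f1) (psiP s).1 rmorph1.
have j12 a : j1 (f1 a) = j2 (f2 a).
  rewrite j1E j2E; apply/cP; apply: filterS filterT => s _ /=.
  by rewrite (psiP s).1.
exists F, j1, j2; split=> // x y jxy; move: (jxy); rewrite j1E j2E.
(* An equality of classes holds at some index [s], where it reads [f2 (psi s x) = y]. *)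
move=> /cP/filter_ex[s /= ys]; exists (psi s x); split=> //.
by apply: (fmorph_inj j1); rewrite j12 ys.
Qed.

Lemma embedding_of_rmorphism (A F : expField) (j : {rmorphism A -> F}) :
  {morph j : x / expE x >-> expE x} -> exists g : embedding A F, g =1 j.
Proof. by move=> jE; exists (Embedding (@fmorph_inj _ _ j) jE). Qed.

Lemma expE0 (A : expField) : expE (0 : A) = 1.
Proof.
apply: (mulfI (expE_neq0 (0 : A))).
by rewrite -expED addr0 mulr1.
Qed.

Lemma EA_field_disjoint_amalgamation_base (A : expField) :
  EA_field A -> disjoint_amalgamation_base A.
Proof.
move=> clA B1 B2 f1 f2.
have [F [j1 [j2 [j12 jdisj]]]] := field_disjoint_amalgam f1 f2 clA.
have F0 : [pchar F] =i pred0.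
  by move=> p; rewrite (fmorph_pchar j1) expField_pchar0.
have [|u uE] := @additive_of_morph (B1 * B2)%type F (fun z => j1 z.1 + j2 z.2).
  by move=> [x y] [x' y'] /=; rewrite !rmorphD addrACA.
pose e (z : B1 * B2) := j1 (expE z.1) * j2 (expE z.2).
have [||||E [E0 ED Eu _]] := @exp_extension (B1 * B2)%type F u e F0.
- by apply: divisible_prod; apply: pchar0_divisible; apply: expField_pchar0.
- by move=> z; rewrite mulf_neq0 // fmorph_eq0 expE_neq0.
- by move=> z z'; rewrite /e /= !expED !rmorphM mulrACA.
(* By disjointness the kernel of [u] consists of the pairs [(f1 a, - f2 a)], on which the two
   exponentials cancel. *)
- move=> [x y]; rewrite uE /e /= => /eqP; rewrite addr_eq0 -rmorphN => /eqP.
  move=> /jdisj[a [-> yE]]; rewrite -(opprK y) yE -rmorphN -!embeddingE -j12.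
  by rewrite -rmorphM -rmorphM -expED subrr expE0 !rmorph1.
pose C := ExpField F0 E0 ED.
have [|g1 g1E] := @embedding_of_rmorphism B1 C j1.
  move=> x; have := Eu (x, 0); rewrite uE /e /= rmorph0 addr0 expE0 rmorph1 mulr1.
  by [].
have [|g2 g2E] := @embedding_of_rmorphism B2 C j2.
  move=> x; have := Eu (0, x); rewrite uE /e /= rmorph0 add0r expE0 rmorph1 mul1r.
  by [].
exists C, g1, g2; split=> [a|]; first by rewrite /= g1E g2E.
apply/seteqP; split=> [_ [[x _ <-] [y _]]|_ [a _ <-]].
  by rewrite g1E g2E => /esym/jdisj[a [-> _]]; exists a => //=; rewrite g1E.
by split; [exists (f1 a)|exists (f2 a) => //=; rewrite g1E g2E].
Qed.

(** * The converse: splitting fields, rational powers, two incompatible exponentials *)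

Lemma irreducible_factor (K : fieldType) (p : {poly K}) :
  (1 < size p)%N -> exists2 q, irreducible_poly q & q %| p.
Proof.
move=> p1; have p0 : p != 0 by rewrite -size_poly_gt0 ltnW.
have [|q [q1 qp] minq] := @min_size_poly K (fun q => (1 < size q)%N /\ q %| p).
  by exists p.
exists q => //; split=> // d d1 dq; rewrite -dvdp_size_eqp //.
have q0 : q != 0 by rewrite -size_poly_gt0 ltnW.
rewrite eqn_leq dvdp_leq //= minq //; split; last exact: dvdp_trans qp.
have : d != 0 by apply: contraNneq q0 => d0; rewrite -dvd0p -d0.
by rewrite -size_poly_gt0; case: (size d) d1 => [|[]].
Qed.

Lemma splitting_field_exists (A : fieldType) (p : {poly A}) : p != 0 ->
  exists (L : fieldType) (i : {rmorphism A -> L}) (rs : seq L),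
    map_poly i p %= \prod_(r <- rs) ('X - r%:P).
Proof.
have [n] := ubnP (size p); elim: n => // n IHn in A p *; rewrite ltnS => pn p0.
have [p1|p1] := leqP (size p) 1.
  exists A, idfun, [::]; rewrite map_poly_id // big_nil -size_poly_eq1.
  by rewrite eqn_leq p1 size_poly_gt0.
have [q /irredp_FAdjoin[L1 _ [z qz _]] qp] := irreducible_factor p1.
have : root (map_poly (in_alg L1) p) z.
  by apply: root_dvdp qz; rewrite dvdp_map.
move=> /factor_theorem[q' pE].
have sz : size p = (size q').+1.
  rewrite -(size_map_poly (in_alg L1)) pE size_Mmonic ?monicXsubC //.
    by rewrite size_XsubC addn2.
  by apply: contraNneq p0 => q0; rewrite -(map_poly_eq0 (in_alg L1)) pE q0 mul0r.
have [||L [i [rs q'E]]] := IHn L1 q'.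
- by rewrite -ltnS -sz.
- by rewrite -size_poly_gt0 -ltnS -sz.
exists L, (i \o in_alg L1), (i z :: rs).
rewrite map_poly_comp pE rmorphM rmorphB /= map_polyX map_polyC big_cons mulrC.
exact: eqp_mull.
Qed.

Lemma pchar0_intf_neq0 (F : fieldType) (z : int) :
  [pchar F] =i pred0 -> z != 0 -> z%:~R != 0 :> F.
Proof.
move=> F0; case: z => [[|n]|n] // _; first exact: pchar0_natf_neq0.
by rewrite NegzE rmorphN oppr_eq0; apply: pchar0_natf_neq0.
Qed.

Lemma ratrD_pchar0 (F : fieldType) :
  [pchar F] =i pred0 -> {morph (@ratr F) : x y / x + y}.
Proof.
move=> F0 x y.
have den0 (q : rat) : (denq q)%:~R != 0 :> F by rewrite pchar0_intf_neq0 ?denq_neq0.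
(* Transfers identities with cleared denominators from [rat] to [F]. *)
have key (q : rat) (a b : int) : q * b%:~R = a%:~R -> ratr q * b%:~R = a%:~R :> F.
  move=> qb; rewrite /ratr mulrAC; apply: (canLR (mulfK (den0 q))).
  rewrite -!rmorphM /=; congr (_%:~R); apply: (@intr_inj rat).
  by rewrite !rmorphM /= -qb mulrAC -numqE.
apply: (mulIf (mulf_neq0 (den0 x) (den0 y))).
rewrite -rmorphM (@key _ (numq x * denq y + numq y * denq x)); last first.
  by rewrite rmorphD !rmorphM /= !numqE; ring.
by rewrite !rmorphD !rmorphM /= /ratr; field; rewrite !den0.
Qed.

Lemma ratr1 (F : fieldType) : ratr 1 = 1 :> F.
Proof. by rewrite /ratr divr1. Qed.

Lemma rat_fact_int (q : rat) (n : nat) : (`|denq q| <= n)%N ->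
  exists z : int, q * n`!%:R = z%:~R.
Proof.
move=> qn; have /dvdnP[m mE] : (`|denq q| %| n`!)%N.
  by apply: dvdn_fact; rewrite qn absz_gt0 denq_neq0.
exists (numq q * m%:Z); rewrite mE natrM mulrCA rmorphM /= numqE.
by rewrite [RHS]mulrC -[in RHS](absz_denq q).
Qed.

Section RationalPowers.

Variables (L : fieldType) (U : set_system nat).
Hypotheses (ultraU : UltraFilter U) (Uge : forall n, U [set m | (n <= m)%N]).
Variables (F : fieldType) (c : {rmorphism (nat -> {fraction {poly L}}) -> F}).
Hypothesis cP : forall f g, c f = c g <-> U [set i | f i = g i].

(* For each [q] the exponent is eventually the integer [q * n!]; the values of
   [numq] at the finitely many other [n] are junk. *)
Definition rat_power (q : rat) : F :=
  c (fun n => (tofrac 'X : {fraction {poly L}}) ^ numq (q * n`!%:R)).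

Let X0 : tofrac 'X != 0 :> {fraction {poly L}}.
Proof. by rewrite tofrac_eq0 polyX_eq0. Qed.

Lemma rat_powerD : {morph rat_power : q r / q + r >-> q * r}.
Proof.
move=> q r; rewrite -rmorphM; apply/cP.
apply: filterS (filterI (Uge `|denq q|) (Uge `|denq r|)) => n /= [qn rn].
rewrite -[RHS]expfzDr //; congr (_ ^ _).
have [a qE] := rat_fact_int qn; have [b rE] := rat_fact_int rn.
by rewrite mulrDl qE rE -rmorphD !numq_int.
Qed.

Lemma rat_power0 : rat_power 0 = 1.
Proof.
rewrite -(rmorph1 c); apply/cP; apply: filterS filterT => n _ /=.
by rewrite mul0r expr0z.
Qed.

Lemma rat_power_neq0 q : rat_power q != 0.
Proof.
have : rat_power q * rat_power (- q) != 0.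
  by rewrite -rat_powerD subrr rat_power0 oner_neq0.
by rewrite mulf_eq0 negb_or => /andP[].
Qed.

(** [X ^ n!] has positive degree, so it is constant at no index. *)
Lemma rat_power1_neq_const (x : L) : rat_power 1 <> c (fun=> tofrac x%:P).
Proof.
move=> /cP/filter_ex[n /= /eqP].
rewrite mul1r -[n`!%:R]/(n`!%:~R) numq_int -exprnP -rmorphXn /=.
rewrite tofrac_eq => /eqP/(congr1 (fun p : {poly L} => size p)).
rewrite size_polyXn => szE; have := size_polyC_leq1 x.
by rewrite -szE ltnNge fact_gt0.
Qed.

End RationalPowers.

Lemma amalgamation_base_EA_field (A : expField) :
  amalgamation_base A -> EA_field A.
Proof.
move=> amalg n P n0; apply: contrapT => noroot.
pose p : {poly A} := 'X^n - \poly_(i < n) P i.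
have szp : size p = n.+1.
  by rewrite size_polyDl ?size_polyXn // size_polyN ltnS size_poly.
have rootp x : ~~ root p x.
  apply/negP => /eqP; rewrite !hornerE horner_poly => /subr0_eq px.
  by apply: noroot; exists x.
have p0 : p != 0 by rewrite -size_poly_gt0 szp.
have [L [i [rs pE]]] := splitting_field_exists p0.
have [b brs] : exists b, b \in rs.
  have := eqp_size pE; rewrite size_map_poly szp size_prod_XsubC => -[].
  case: rs {pE} => [|b rs] /= nE; first by move: n0; rewrite nE.
  by exists b; rewrite inE eqxx.
have bp : root (map_poly i p) b by rewrite (eqp_root pE) root_prod_XsubC.
have bA a : b <> i a.
  by move=> bE; have /negP := rootp a; rewrite -(fmorph_root i) -bE.
have [|||U [ultraU Uge]] := @cofinal_ultrafilter nat (fun n => [set m | (n <= m)%N]).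
- by split; exact: 0%N.
- by move=> k /=.
- move=> k l; exists (maxn k l) => m /=; rewrite geq_max.
  by move=> /andP[].
have [F [c cP]] := @ultrapower_exists nat {fraction {poly L}} U ultraU.
have [j0 j0E] := constant_class_rmorphism c.
have [j jE] : exists j : {rmorphism L -> F}, forall x, j x = c (fun=> tofrac x%:P).
  by exists (j0 \o (@tofrac _) \o polyC) => x; rewrite -j0E.
have [ji jiE] : exists ji : {rmorphism A -> F}, ji =1 j \o i by exists (j \o i).
have A0 := @expField_pchar0 A.
have F0 : [pchar F] =i pred0 by move=> r; rewrite (fmorph_pchar ji) A0.
(* The image is the divisible subgroup [A + Q b] of [F]; the sum is direct because [b] is not in
   [A]. *)
have [|u uE] := @additive_of_morph (A * rat)%type F
    (fun z => ji z.1 + ratr z.2 * j b).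
  by move=> [x q] [x' q'] /=; rewrite (ratrD_pchar0 F0) !rmorphD mulrDl addrACA.
have uker z : u z = 0 -> z = 0.
  case: z => x q; rewrite uE /=; have [->|q0] := eqVneq q 0.
    by rewrite /ratr mul0r mul0r addr0 => /eqP; rewrite fmorph_eq0 => /eqP ->.
  have tE : ji (ratr q) = ratr q by rewrite /ratr fmorph_div !rmorph_int.
  have t0 : ratr q != 0 :> A.
    by rewrite mulf_neq0 ?invr_eq0 ?pchar0_intf_neq0 ?denq_neq0 ?numq_eq0.
  rewrite -tE => /eqP; rewrite addrC addr_eq0 => /eqP bE.
  case: (bA (- x / ratr q)); apply: (fmorph_inj j).
  rewrite -[RHS]jiE fmorph_div rmorphN -bE mulrAC divff ?mul1r //.
  by rewrite fmorph_eq0.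
have divG : divisible (A * rat)%type.
  apply: divisible_prod; apply: pchar0_divisible => //.
  by move=> r; rewrite Num.Theory.pchar_num.
(* [e1] sends [b] to [1], and [e2] sends it to the class of [X ^ n!]. *)
pose e1 (z : A * rat) := ji (expE z.1).
pose e2 (z : A * rat) := ji (expE z.1) * rat_power c z.2.
have ji0 z : ji (expE z) != 0 by rewrite fmorph_eq0 expE_neq0.
have [|||E1 [E1_0 E1D E1u E1im]] := @exp_extension _ F u e1 F0 divG.
- by move=> z; apply: ji0.
- by move=> z z'; rewrite /e1 /= expED rmorphM.
- by move=> z /uker ->; rewrite /e1 /= expE0 rmorph1.
have [|||E2 [E2_0 E2D E2u _]] := @exp_extension _ F u e2 F0 divG.
- by move=> z; rewrite mulf_neq0 ?ji0 // (rat_power_neq0 ultraU Uge cP).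
- by move=> z z'; rewrite /e2 /= expED rmorphM (rat_powerD ultraU Uge cP) mulrACA.
- by move=> z /uker ->; rewrite /e2 /= expE0 rmorph1 mul1r (rat_power0 ultraU cP).
pose B1 := ExpField F0 E1_0 E1D; pose B2 := ExpField F0 E2_0 E2D.
have uA x : u (x, 0) = ji x by rewrite uE /= /ratr mul0r mul0r addr0.
have ub : u (0, 1) = j b by rewrite uE /= ratr1 mul1r rmorph0 add0r.
have [|f1 f1E] := @embedding_of_rmorphism A B1 ji.
  by move=> x; rewrite /= -[X in E1 X]uA E1u.
have [|f2 f2E] := @embedding_of_rmorphism A B2 ji.
  by move=> x; rewrite /= -[X in E2 X]uA E2u /e2 /= (rat_power0 ultraU cP) mulr1.
have [C [g1 [g2 g12]]] := amalg B1 B2 f1 f2.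
have g12ji x : g1 (ji x) = g2 (ji x) by have := g12 x; rewrite /= f1E f2E.
(* [g2 (j b)] is a root of [p] in [C], and [p] already splits there through [g1]. *)
have [r gr] : exists r, g2 (j b) = g1 (j r).
  have : root (map_poly (g2 \o ji) p) (g2 (j b)).
    rewrite map_poly_comp fmorph_root (eq_map_poly jiE).
    by rewrite map_poly_comp fmorph_root.
  rewrite -(@eq_map_poly _ _ (g1 \o ji)) // map_poly_comp (eq_map_poly jiE).
  rewrite map_poly_comp.
  set q := map_poly g1 (map_poly j (\prod_(r <- rs) ('X - r%:P))).
  rewrite (@eqp_root _ _ q) /q.
    rewrite !map_prod_XsubC -(big_map (g1 \o j) xpredT (fun r => 'X - r%:P)).
    by rewrite root_prod_XsubC => /mapP[r _ ->]; exists r.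
  by rewrite !eqp_map.
(* Exponentiating both sides of [gr] gives [g2 (rat_power c 1)] and the [g1]-image of an element of
   [A]. As [g1] and [g2] agree on [A], [rat_power c 1] would be the class of a constant. *)
have := embeddingE g2 (j b).
rewrite gr -embeddingE /= -ub E2u /e2 /= expE0 rmorph1 mul1r.
have [z ->] := E1im (j r); rewrite /e1 g12ji => /(@embedding_inj _ _ g2).
by rewrite jiE /= jE; exact: (rat_power1_neq_const ultraU cP).
Qed.

Theorem theorem4p3 :
  (forall A : expField, amalgamation_base A <-> EA_field A) /\
  (forall A : expField, EA_field A -> disjoint_amalgamation_base A).
Proof.
split=> [A|]; last exact: EA_field_disjoint_amalgamation_base.
split; first exact: amalgamation_base_EA_field.
move=> /EA_field_disjoint_amalgamation_base disj B1 B2 f1 f2.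
by have [C [g1 [g2 [g12 _]]]] := disj B1 B2 f1 f2; exists C, g1, g2.
Qed.
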